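(* Let $G$ be a connected graph on $n\ge2$ vertices, with Laplacian eigenvalues $0=\lambda_1<\lambda_2\le\cdots\le\lambda_n$ and corresponding orthonormal eigenvectors $u_1=\frac1{\sqrt n}\mathbf 1,u_2,\dots,u_n$. Let $U=[u_2\ u_3\ \cdots\ u_n]$, $D_L=\operatorname{diag}(1/\lambda_2,\dots,1/\lambda_n)$, $M_L=U^\top\Delta U$, and \[ C=[D_L,M_L]=D_LM_L-M_LD_L . \] Indexing the rows and columns of $C$ by $2,\dots,n$ (i.e. by $u_2,\dots,u_n$), \[ C_{ij}=\Bigl(\frac1{\lambda_i}-\frac1{\lambda_j}\Bigr)u_i^\top\Delta u_j,\qquad 2\le i,j\le n. \] Consequently, $D_L$ and $M_L$ commute if and only if $u_i^\top\Delta u_j=0$ whenever $\lambda_i\ne\lambda_j$ ($2\le i,j\le n$).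
   Context: $G=(V,E)$ is a finite, simple, connected, undirected, unweighted graph with vertex set $V=\{1,\dots,n\}$. $L=D_G-A$ is its combinatorial Laplacian (degree matrix minus adjacency matrix). $\mathbf 1\in\mathbb R^n$ is the all-ones vector, $I$ the identity matrix. $L^\dagger$ is the Moore--Penrose inverse of $L$, i.e. the unique symmetric matrix with $LL^\dagger=L^\dagger L=I-\frac1n\mathbf 1\mathbf 1^\top$ and $L^\dagger\mathbf 1=\mathbf 0$. Put $d_i=(L^\dagger)_{ii}$, $D=\operatorname{diag}(d_1,\dots,d_n)$, $\bar d=\frac1n\operatorname{tr}(L^\dagger)$, $\Delta=D-\bar d I$ (resistance deviation matrix). *)

(* Defs.v *)
From HB Require Import structures.
From mathcomp Require Import all_boot all_order all_algebra.
From mathcomp Require Import ring.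

Set Implicit Arguments.
Unset Strict Implicit.
Unset Printing Implicit Defensive.

Import Order.TTheory GRing.Theory Num.Theory.
Local Open Scope ring_scope.

(* The real numbers are an arbitrary real closed field R. A finite simple graph
   on n vertices is a symmetric, irreflexive relation on 'I_n. *)

Definition graph_connected n (e : rel 'I_n) : Prop :=
  forall i j, connect e i j.

Section Laplacian.
Variables (R : rcfType) (n : nat).
Implicit Types (e : rel 'I_n) (Ld : 'M[R]_n).

Definition degree e (i : 'I_n) : nat := #|[set j | e i j]|.

Definition adjacency e : 'M[R]_n := \matrix_(i, j) (e i j)%:R.

Definition laplacian e : 'M[R]_n :=
  diag_mx (\row_i (degree e i)%:R) - adjacency e.

Definition ones : 'cV[R]_n := const_mx 1.

(* Moore-Penrose inverse of the Laplacian of a connected graph, see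
   [laplacian_pinv_exists] and [laplacian_pinv_unique] *)
Definition is_laplacian_pinv e Ld : Prop :=
  [/\ Ld^T = Ld,
      laplacian e *m Ld = 1%:M - n%:R^-1 *: (ones *m ones^T),
      Ld *m laplacian e = 1%:M - n%:R^-1 *: (ones *m ones^T)
    & Ld *m ones = 0].

Definition resistance_deviation Ld : 'M[R]_n :=
  diag_mx (\row_i Ld i i) - (n%:R^-1 * \tr Ld)%:M.

Definition bilin (x : 'cV[R]_n) (A : 'M[R]_n) (y : 'cV[R]_n) : R :=
  (x^T *m A *m y) 0 0.

Definition commutator (A B : 'M[R]_n) : 'M[R]_n := A *m B - B *m A.

End Laplacian.

Arguments laplacian R {n} e.
Arguments ones R n : clear implicits.

Section Spectral.
Variables (R : rcfType) (n : nat).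

(* Eigenpairs are indexed from 0, so lambda_1 and u_1 = ones / sqrt n are
   [lam ord0] and [u ord0], and [lift ord0 i] (of value i + 1), for i : 'I_n,
   runs through the indices of lambda_2, u_2, and so on. *)

Definition eigvec_mx (u : 'I_n.+1 -> 'cV[R]_n.+1) : 'M[R]_(n.+1, n) :=
  \matrix_(k, i) u (lift ord0 i) k 0.

Definition inv_eigval_mx (lam : 'I_n.+1 -> R) : 'M[R]_n :=
  diag_mx (\row_i (lam (lift ord0 i))^-1).

Definition compressed_deviation (u : 'I_n.+1 -> 'cV[R]_n.+1)
    (Ld : 'M[R]_n.+1) : 'M[R]_n :=
  (eigvec_mx u)^T *m resistance_deviation Ld *m eigvec_mx u.

End Spectral.

Section PinvExistsUnique.
Variables (R : rcfType) (n : nat) (e : rel 'I_n).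
Hypotheses (esym : symmetric e).

Local Notation L := (laplacian R e).
Local Notation one := (ones R n).
Local Notation J := (one *m one^T).

Lemma laplacian_pinv_unique (X Y : 'M[R]_n) :
  is_laplacian_pinv e X -> is_laplacian_pinv e Y -> X = Y.
Proof.
case=> _ _ XL X1 [YT LY _ Y1].
have J1Y : one^T *m Y = 0 by rewrite -{1}YT -trmx_mul Y1 trmx0.
have : X *m (L *m Y) = X *m L *m Y by rewrite mulmxA.
rewrite LY XL mulmxBr mulmxBl mulmx1 mul1mx -scalemxAr mulmxA X1 mul0mx.
by rewrite -scalemxAl -mulmxA J1Y mulmx0 !scaler0 !subr0.
Qed.

Lemma laplacianE (x : 'cV[R]_n) i :
  (L *m x) i 0 = \sum_j (e i j)%:R * (x i 0 - x j 0).
Proof.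
rewrite mulmxBl mul_diag_mx !mxE.
under [RHS]eq_bigr do rewrite mulrBr.
rewrite sumrB -mulr_suml; congr (_ * _ - _).
  rewrite -natr_sum /degree -sum1_card; congr (_%:R).
  by rewrite big_mkcond; apply: eq_bigr => j _; rewrite inE; case: (e i j).
by apply: eq_bigr => j _; rewrite mxE.
Qed.

Lemma laplacian_form (x : 'cV[R]_n) :
  \sum_i \sum_j (e i j)%:R * (x i 0 - x j 0) ^+ 2 =
  2 * \sum_i x i 0 * (L *m x) i 0.
Proof.
have E : \sum_i x i 0 * (L *m x) i 0 =
    \sum_i \sum_j (e i j)%:R * (x i 0 * (x i 0 - x j 0)).
  apply: eq_bigr => i _; rewrite laplacianE mulr_sumr.
  by apply: eq_bigr => j _; rewrite mulrCA.
rewrite mulr_natl mulr2n {1}E E [X in _ + X]exchange_big /= -big_split /=.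
apply: eq_bigr => i _; rewrite -big_split /=.
by apply: eq_bigr => j _; rewrite (esym j i); ring.
Qed.

Lemma trmx_laplacian : L^T = L.
Proof.
apply/matrixP => i j; rewrite !mxE esym.
by case: (eqVneq i j) => [->|_]; rewrite ?mulr1n ?mulr0n.
Qed.

Lemma laplacian_ones : L *m one = 0.
Proof.
apply/colP => i; rewrite laplacianE [RHS]mxE big1 // => j _.
by rewrite !mxE subrr mulr0.
Qed.

Hypotheses (n_gt0 : (0 < n)%N) (econn : graph_connected e).

Lemma laplacian_ker (x : 'cV[R]_n) :
  L *m x = 0 -> forall i j, x i 0 = x j 0.
Proof.
move=> Lx0; have := laplacian_form x.
have -> : \sum_i x i 0 * (L *m x) i 0 = 0.
  by rewrite big1 // => i _; rewrite Lx0 mxE mulr0.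
rewrite mulr0 => S0.
have t_ge0 i j : 0 <= (e i j)%:R * (x i 0 - x j 0) ^+ 2.
  by rewrite mulr_ge0 ?ler0n ?sqr_ge0.
have edge i j : e i j -> x i 0 = x j 0.
  move=> eij; move/eqP: S0; rewrite psumr_eq0 => [/allP/(_ i)|k _]; last first.
    by apply: sumr_ge0.
  rewrite mem_index_enum => /(_ isT); rewrite /= psumr_eq0 //.
  move/allP/(_ j); rewrite mem_index_enum => /(_ isT).
  by rewrite /= eij mul1r sqrf_eq0 subr_eq0 => /eqP.
move=> i j; case/connectP: (econn i j) => p ep ->.
elim: p i ep => //= k p IH i /andP[eik ekp].
by rewrite (edge _ _ eik) IH.
Qed.

Local Notation c := (n%:R^-1 : R).

Lemma laplacian_pinv_exists : exists X : 'M[R]_n, is_laplacian_pinv e X.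
Proof.
have n0 : (n%:R : R) != 0 by rewrite pnatr_eq0 -lt0n.
have oneone : one^T *m one = n%:R%:M.
  apply/matrixP => i j; rewrite !mxE !ord1 mulr1n.
  under eq_bigr do rewrite !mxE mulr1.
  by rewrite sumr_const card_ord.
have oneL : one^T *m L = 0 by rewrite -trmx_laplacian -trmx_mul laplacian_ones trmx0.
pose M := L + c *: J.
have oneM : one^T *m M = one^T.
  by rewrite mulmxDr oneL add0r -scalemxAr mulmxA oneone mul_scalar_mx scalerA mulVf // scale1r.
have MT : M^T = M.
  by rewrite linearD linearZ /= trmx_laplacian trmx_mul trmxK.
have Mone : M *m one = one by rewrite -{1}MT -[one in LHS]trmxK -trmx_mul oneM trmxK.
have Mker (x : 'cV_n) : M *m x = 0 -> x = 0.
  move=> Mx0.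
  have x1 : one^T *m x = 0 by rewrite -oneM -mulmxA Mx0 mulmx0.
  have Lx0 : L *m x = 0.
    move: Mx0; rewrite mulmxDl -scalemxAl -mulmxA x1 mulmx0 scaler0.
    by rewrite addr0.
  apply/colP => i; rewrite mxE; move/matrixP/(_ 0 0): x1; rewrite !mxE.
  under eq_bigr => j _ do rewrite !mxE mul1r (laplacian_ker Lx0 j i).
  rewrite sumr_const card_ord -mulr_natr => /eqP.
  by rewrite mulf_eq0 (negPf n0) orbF => /eqP.
have Mu : M \in unitmx.
  rewrite -row_free_unit -kermx_eq0; apply/eqP/row_matrixP => k; rewrite row0.
  apply: trmx_inj; rewrite trmx0; apply: Mker.
  by rewrite -{1}MT -trmx_mul -row_mul mulmx_ker row0 trmx0.
have MVone : invmx M *m one = one by rewrite -{1}Mone mulKmx.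
have oneMV : one^T *m invmx M = one^T by rewrite -{1}oneM mulmxK.
have LE : L = M - c *: J by rewrite addrK.
have XT : (invmx M - c *: J)^T = invmx M - c *: J.
  by rewrite linearB linearZ /= trmx_inv MT trmx_mul trmxK.
have LX : L *m (invmx M - c *: J) = 1%:M - c *: J.
  rewrite mulmxBr -scalemxAr mulmxA laplacian_ones mul0mx scaler0 subr0.
  by rewrite {1}LE mulmxBl mulmxV // -scalemxAl -mulmxA oneMV.
exists (invmx M - c *: J); split => //.
  rewrite -[LHS]trmxK trmx_mul XT trmx_laplacian LX.
  by rewrite linearB linearZ /= trmx1 trmx_mul trmxK.
rewrite mulmxBl MVone -scalemxAl -mulmxA oneone mul_mx_scalar scalerA.
by rewrite mulVf // scale1r subrr.
Qed.

End PinvExistsUnique.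

(* Main.v *)
Require Import Defs.
From mathcomp Require Import all_boot all_order all_algebra.
Import Order.TTheory GRing.Theory Num.Theory.
Local Open Scope ring_scope.

(** The matrix U^T Delta U is the Gram matrix of the bilinear form of Delta on
    the vectors u_2, ..., u_n, and commuting a matrix with a diagonal matrix
    acts entry by entry: entry (i, j) of diag(d) M - M diag(d) is
    (d_i - d_j) M_ij.  With d_i = 1 / lambda_i this is the formula for the
    commutator ([commutator_diag_mxE], [compressed_deviationE]).  Such a
    commutator vanishes exactly when M_ij = 0 wherever d_i and d_j differ
    ([comm_diag_mxP]), and inversion is injective, so 1 / lambda_i and
    1 / lambda_j differ exactly when lambda_i and lambda_j do. *)

Lemma commutator_diag_mxE (R : rcfType) (n : nat) (d : 'rV[R]_n) (M : 'M[R]_n)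
    (i j : 'I_n) :
  commutator (diag_mx d) M i j = (d 0 i - d 0 j) * M i j.
Proof.
by rewrite /commutator mul_diag_mx mul_mx_diag !mxE (mulrC (M i j)) -mulrBl.
Qed.

(** Over a field, a factor d_i - d_j that is nonzero can be cancelled, so a
    matrix commutes with diag(d) if and only if it is block diagonal for the
    level sets of d. *)
Lemma comm_diag_mxP (R : rcfType) (n : nat) (d : 'rV[R]_n) (M : 'M[R]_n) :
  comm_mx (diag_mx d) M <-> forall i j, d 0 i <> d 0 j -> M i j = 0.
Proof.
split=> [dM i j /eqP dij | M0].
  have := commutator_diag_mxE R n d M i j.
  rewrite /commutator dM subrr mxE => /esym/eqP.
  by rewrite mulf_eq0 subr_eq0 (negPf dij) => /eqP.
apply/eqP; rewrite -subr_eq0; apply/eqP/matrixP => i j.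
rewrite [LHS]commutator_diag_mxE mxE.
have [->|/eqP dij] := eqVneq (d 0 i) (d 0 j); first by rewrite subrr mul0r.
by rewrite M0 // mulr0.
Qed.

Lemma compressed_deviationE (R : rcfType) (n : nat)
    (u : 'I_n.+1 -> 'cV[R]_n.+1) (Ld : 'M[R]_n.+1) (i j : 'I_n) :
  compressed_deviation u Ld i j =
  bilin (u (lift ord0 i)) (resistance_deviation Ld) (u (lift ord0 j)).
Proof.
have colU k : col k (eigvec_mx u) = u (lift ord0 k).
  by apply/colP => l; rewrite !mxE.
rewrite /bilin /compressed_deviation -!colU tr_col -row_mul colE mulmxA -row_mul -colE.
by rewrite [RHS]mxE [RHS]mxE.
Qed.

Theorem proposition2p13 (R : rcfType) (n : nat) (n_ge2 : (2 <= n.+1)%N)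
    (e : rel 'I_n.+1) (e_sym : symmetric e) (e_irr : irreflexive e)
    (e_conn : graph_connected e)
    (Ld : 'M[R]_n.+1) (Ld_pinv : is_laplacian_pinv e Ld)
    (lam : 'I_n.+1 -> R) (u : 'I_n.+1 -> 'cV[R]_n.+1)
    (lam_eig : forall i, laplacian R e *m u i = lam i *: u i)
    (u_orthonormal : forall i j, (u i)^T *m u j = (i == j)%:R%:M)
    (lam1 : lam ord0 = 0)
    (u1 : u ord0 = (Num.sqrt n.+1%:R)^-1 *: ones R n.+1)
    (lam_gt0 : forall i : 'I_n.+1, (0 < i)%N -> 0 < lam i)
    (lam_sorted : forall i j : 'I_n.+1, (i <= j)%N -> lam i <= lam j) :
  let Delta := resistance_deviation Ld in
  let DL := inv_eigval_mx lam in
  let ML := compressed_deviation u Ld in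
  let C := commutator DL ML in
  (forall i j : 'I_n,
     C i j = ((lam (lift ord0 i))^-1 - (lam (lift ord0 j))^-1)
             * bilin (u (lift ord0 i)) Delta (u (lift ord0 j)))
  /\ (comm_mx DL ML <->
      forall i j : 'I_n, lam (lift ord0 i) <> lam (lift ord0 j) ->
        bilin (u (lift ord0 i)) Delta (u (lift ord0 j)) = 0).
Proof.
move=> Delta DL ML C; split=> [i j|].
  by rewrite /C commutator_diag_mxE compressed_deviationE !mxE.
have inv_neq (i j : 'I_n) :
    (\row_k (lam (lift ord0 k))^-1) 0 i <> (\row_k (lam (lift ord0 k))^-1) 0 j
    <-> lam (lift ord0 i) <> lam (lift ord0 j).
  by rewrite !mxE; split=> ne eq; apply: ne; [rewrite eq | apply: invr_inj].
split=> [/comm_diag_mxP ML0 i j /inv_neq/ML0 <-|bilin0].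
  by rewrite compressed_deviationE.
apply/comm_diag_mxP => i j /inv_neq/bilin0 <-.
by rewrite compressed_deviationE.
Qed.
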